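(* Let $Q$ be a profinite quandle. Then $\mathrm{End}(Q)$ (respectively, $\mathrm{Aut}(Q)$) is compact in the compact-open topology if and only if $Q$ admits a fundamental system of open fully invariant (respectively, characteristic) congruences.
   Context: A quandle is a non-empty set $Q$ with a binary operation $*$ such that $x*x=x$; for all $x,y$ there is a unique $z$ with $x=z*y$ (write $z=x*^{-1}y$); and $(x*y)*z=(x*z)*(y*z)$. A topological quandle is a quandle with a topology such that $*$ is continuous and each right multiplication $R_q:p\mapsto p*q$ is a homeomorphism. A profinite quandle is a projective limit of a projective system (over a directed set) of finite discrete quandles $Q_i$ with homomorphisms $\varphi_{ij}:Q_j\to Q_i$, i.e. $\{(q_i)\in\prod_i Q_i:\varphi_{ij}(q_j)=q_i \text{ for } i\le j\}$ with the subspace topology of the product topology; it is a compact Hausdorff topological quandle. $\mathrm{End}(Q)$ denotes the monoid of continuous quandle endomorphisms and $\mathrm{Aut}(Q)$ the group of continuous quandle automorphisms, with the compact-open topology inherited from the space $C(Q,Q)$ of continuous maps. A congruence on $Q$ is an equivalence relation compatible with $*$ and $*^{-1}$; it is open if it is open in $Q\times Q$. A congruence $\alpha$ is fully invariant (respectively, characteristic) if $(x,y)\in\alpha$ implies $(f(x),f(y))\in\alpha$ for all $f\in\mathrm{End}(Q)$ (respectively, all $f\in\mathrm{Aut}(Q)$). The unique uniformity on the compact Hausdorff space $Q$ has as entourages all neighborhoods of the diagonal in $Q\times Q$; a fundamental system of congruences is a family of congruences that are entourages such that every entourage contains a member of the family. *)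

(* Defs.v *)
From HB Require Import structures.
From mathcomp Require Import all_boot all_order.
From mathcomp Require Import all_classical topology.

Set Implicit Arguments.
Unset Strict Implicit.
Unset Printing Implicit Defensive.

Local Open Scope classical_set_scope.

Declare Scope quandle_scope.
Delimit Scope quandle_scope with quandle.
Reserved Notation "x |> y" (at level 40, left associativity).
Reserved Notation "x |>^-1 y" (at level 40, left associativity).
Local Open Scope quandle_scope.

HB.mixin Record isQuandle T of Choice T := {
  qop : T -> T -> T;
  quandle_nonempty : [set: T] !=set0;
  qopxx : forall x, qop x x = x;
  qop_uniq_solvable : forall x y, exists! z, x = qop z y;
  qop_distr : forall x y z, qop (qop x y) z = qop (qop x z) (qop y z)
}.

#[short(type="quandleType")]
HB.structure Definition Quandle := { T of isQuandle T & Choice T }.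

Notation "x |> y" := (qop x y) : quandle_scope.

(* The default value [x] of [xget] is never reached, by [qop_uniq_solvable]. *)
Definition qdiv (Q : quandleType) (x y : Q) : Q :=
  xget x [set z | x = z |> y].

Notation "x |>^-1 y" := (qdiv x y) : quandle_scope.

Lemma qdivK (Q : quandleType) (x y : Q) : (x |>^-1 y) |> y = x.
Proof.
rewrite /qdiv; case: xgetP => [z -> // | none].
by have [z [xE _]] := qop_uniq_solvable x y; case: (none z).
Qed.

Lemma qopK (Q : quandleType) (x y : Q) : (x |> y) |>^-1 y = x.
Proof.
have [z [_ zU]] := qop_uniq_solvable (x |> y) y.
by transitivity z; [apply/esym/zU; rewrite qdivK | exact: zU].
Qed.

Definition quandle_hom (P Q : quandleType) (f : P -> Q) : Prop :=
  {morph f : x y / x |> y}.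

Definition homeomorphism (X Y : topologicalType) (f : X -> Y) : Prop :=
  continuous f /\
  exists g : Y -> X, [/\ continuous g, cancel f g & cancel g f].

HB.mixin Record Quandle_isTopological T of Quandle T & Topological T := {
  qop_continuous : continuous (fun p : T * T => p.1 |> p.2);
  qop_homeomorphism : forall q : T, homeomorphism (fun p : T => p |> q)
}.

#[short(type="topQuandleType")]
HB.structure Definition TopQuandle :=
  { T of Quandle T & Topological T & Quandle_isTopological T }.

Definition directed (d : Order.disp_t) (I : preorderType d) : Prop :=
  [set: I] !=set0 /\
  forall i j : I, exists k : I, (i <= k)%O /\ (j <= k)%O.

Record finQuandle_system (d : Order.disp_t) (I : preorderType d) := {
  fqs_obj :> I -> quandleType;
  fqs_finite : forall i, finite_set [set: fqs_obj i];
  fqs_map : forall i j, (i <= j)%O -> fqs_obj j -> fqs_obj i;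
  fqs_hom : forall i j (ij : (i <= j)%O), quandle_hom (fqs_map ij);
  fqs_id : forall i (ii : (i <= i)%O) x, fqs_map ii x = x;
  fqs_comp : forall i j k (ij : (i <= j)%O) (jk : (j <= k)%O) (ik : (i <= k)%O) x,
    fqs_map ij (fqs_map jk x) = fqs_map ik x
}.

Definition fqs_prod (d : Order.disp_t) (I : preorderType d)
    (S : finQuandle_system I) : topologicalType :=
  prod_topology (fun i => discrete_topology (S i)).

Definition fqs_lim (d : Order.disp_t) (I : preorderType d)
    (S : finQuandle_system I) : set (fqs_prod S) :=
  [set q | forall i j (ij : (i <= j)%O), fqs_map ij (q j) = q i].
Arguments fqs_lim {d I} S.

(* [fqs_lim S], coerced to a type, carries the subspace topology of the product;
   its quandle operation is pointwise, so it is not packaged separately. *)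
Definition profinite (Q : topQuandleType) : Prop :=
  exists (d : Order.disp_t) (I : preorderType d) (S : finQuandle_system I),
    directed I /\
    exists h : Q -> fqs_lim S,
      homeomorphism h /\
      forall (x y : Q) (i : I),
        set_val (h (x |> y)) i = (set_val (h x) i : S i) |> set_val (h y) i.

(* Compactness of these sets in [{compact-open, Q -> Q}] is compactness for the
   topology they inherit from [C(Q, Q)]. *)
Definition qEnd (Q : topQuandleType) : set {compact-open, Q -> Q} :=
  [set f : Q -> Q | continuous f /\ quandle_hom f].
Arguments qEnd Q : clear implicits.

(* On a profinite (hence compact Hausdorff) quandle the inverse of such a map is
   automatically continuous. *)
Definition qAut (Q : topQuandleType) : set {compact-open, Q -> Q} :=
  [set f : Q -> Q | [/\ continuous f, quandle_hom f & bijective f]].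
Arguments qAut Q : clear implicits.

Definition congruence (Q : quandleType) (a : set (Q * Q)) : Prop :=
  [/\ forall x, a (x, x),
      forall x y, a (x, y) -> a (y, x),
      forall x y z, a (x, y) -> a (y, z) -> a (x, z),
      forall x y x' y', a (x, y) -> a (x', y') -> a (x |> x', y |> y') &
      forall x y x' y', a (x, y) -> a (x', y') -> a (x |>^-1 x', y |>^-1 y')].

Definition fully_invariant (Q : topQuandleType) (a : set (Q * Q)) : Prop :=
  forall f : Q -> Q, qEnd Q f -> forall x y, a (x, y) -> a (f x, f y).

Definition characteristic (Q : topQuandleType) (a : set (Q * Q)) : Prop :=
  forall f : Q -> Q, qAut Q f -> forall x y, a (x, y) -> a (f x, f y).

(* The entourages of the unique compatible uniformity when [Q] is compact
   Hausdorff. *)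
Definition diag_entourage (Q : topologicalType) : set_system (Q * Q) :=
  set_nbhs diagonal.

Definition fundamental_system (Q : topQuandleType) (B : set_system (Q * Q)) :
    Prop :=
  (forall a, B a -> congruence a /\ diag_entourage a) /\
  (forall U, diag_entourage U -> exists2 a, B a & a `<=` U).

(* Main.v *)
Require Import Defs.
From HB Require Import structures.
From mathcomp Require Import all_boot all_order.
From mathcomp Require Import all_classical topology.

Set Implicit Arguments.
Unset Strict Implicit.
Unset Printing Implicit Defensive.

(** Both equivalences are an instance of one principle about a set [M] of
    continuous endomorphisms of [Q], of the kind found in the Arzela-Ascoli
    theorem: on the compact space [Q], the compact-open topology is uniform
    convergence, and compactness of [M] amounts to equicontinuity together with
    closedness of [M] under uniform limits.

    The topological input on [Q] is that it is compact and Hausdorff and that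
    every entourage contains an open congruence
    ([profinite_open_congruence]): the kernel of the projection to a far enough
    finite quotient.

    Suppose that [M] is a compact monoid. Inside an entourage [U] choose an open
    congruence [a], and let [b] be the set of the pairs that every member of [M]
    sends into [a]. Then [b] is a congruence; it is [M]-invariant because [M] is
    closed under composition, and contained in [U] because [M] contains the
    identity. It is open because [M] is equicontinuous
    ([compact_equicontinuous]), so these [b] form the required fundamental
    system ([compact_invariant_fundamental_system]).

    Suppose conversely that there is a fundamental system of open [M]-invariant
    congruences, and let an ultrafilter live on [M]. It converges pointwise to
    some [g] since [Q] is compact. Each [a] in the system is preserved by all of
    [M] simultaneously, which makes [M] equicontinuous; hence [g] is continuous
    and the convergence is uniform ([ultra_uniform_limit]). The limit [g] is
    again an endomorphism, which settles the case of [qEnd Q]. For [qAut Q] one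
    must see that [g] is bijective ([qAut_uniform_limit]): it has dense and
    closed image, and it is injective because the inverses of automorphisms are
    automorphisms too, so that members of [M] reflect the congruences of the
    system as well as preserving them. *)

Local Open Scope classical_set_scope.
Local Open Scope quandle_scope.

(** * Projective limits of finite quandles *)

Definition fiber (d : Order.disp_t) (I : preorderType d)
    (S : finQuandle_system I) (i : I) (t : fqs_lim S) : set (fqs_lim S) :=
  [set s | set_val s i = set_val t i].

Lemma fqs_lim_coord (d : Order.disp_t) (I : preorderType d)
    (S : finQuandle_system I) (i j : I) (ij : (i <= j)%O) (t : fqs_lim S) :
  fqs_map ij (set_val t j) = set_val t i.
Proof. exact: (set_valP t). Qed.

Lemma fiber_nbhs (d : Order.disp_t) (I : preorderType d)
    (S : finQuandle_system I) (i : I) (t : fqs_lim S) : nbhs t (fiber i t).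
Proof.
have cval : continuous (set_val : fqs_lim S -> fqs_prod S).
  exact: initial_continuous.
have cproj :
    continuous (fun x : fqs_prod S => x i : discrete_topology (S i)).
  exact: (@proj_continuous I (fun i => discrete_topology (S i))).
exact: (cval t _ (cproj (set_val t) _ (discrete_set1 _))).
Qed.

Lemma fiber_le (d : Order.disp_t) (I : preorderType d)
    (S : finQuandle_system I) (i j : I) (s t : fqs_lim S) :
  (i <= j)%O -> fiber j t s -> fiber i t s.
Proof.
move=> ij; rewrite /fiber/= => sj.
by rewrite -(fqs_lim_coord ij s) -(fqs_lim_coord ij t) sj.
Qed.

Lemma fiber_filter (d : Order.disp_t) (I : preorderType d)
    (S : finQuandle_system I) (t : fqs_lim S) :
  directed I -> Filter (filter_from [set: I] (fun i => fiber i t)).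
Proof.
move=> [[i0 _] dI]; apply: filter_from_filter; first by exists i0.
move=> i j _ _; have [k [ik jk]] := dI i j; exists k => // s st.
by split; apply: fiber_le st.
Qed.

(** Directedness is what lets a single coordinate do: a basic neighbourhood in
    the product constrains finitely many coordinates, all of which are
    determined by one coordinate above them. In the proof, this is the
    convergence to [t] of the filter generated by the fibers, which can be
    tested one coordinate at a time. *)
Lemma fiber_basis (d : Order.disp_t) (I : preorderType d)
    (S : finQuandle_system I) (t : fqs_lim S) (N : set (fqs_lim S)) :
  directed I -> nbhs t N -> exists i, fiber i t `<=` N.
Proof.
move=> dI Nt; have FF := fiber_filter t dI.
pose G := filter_from [set: I] (fun i => fiber i t).
have FG : Filter (set_val @ G) by exact: fmap_filter.
have Gt : (set_val @ G : set_system (fqs_prod S)) --> (set_val t : fqs_prod S).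
  apply/cvg_sup => i V [_ [[B _ <-] Bt BV]].
  by exists i => // s si; apply: BV; rewrite /= /proj si.
have : G N.
  move: Nt => [_ [[A oA <-] At AN]].
  have : nbhs (set_val t : fqs_prod S) A by apply: open_nbhs_nbhs.
  by move=> /Gt [i _ iA]; exists i => // s /iA /AN.
by case=> i _ iN; exists i.
Qed.

(** An ultrafilter on the limit decides each coordinate, these being finitely
    valued; the decided values are compatible since any two of them are attained
    simultaneously by some thread. *)
Lemma fqs_lim_compact (d : Order.disp_t) (I : preorderType d)
    (S : finQuandle_system I) : directed I -> compact [set: fqs_lim S].
Proof.
move=> dI; rewrite compact_ultra => F UF _.
have coord i : exists c : S i, F [set s | set_val s i = c].
  pose p (s : fqs_lim S) : discrete_topology (S i) := set_val s i.
  have cS : compact [set: discrete_topology (S i)].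
    by apply: finite_compact; exact: fqs_finite.
  have [|c [_ cc]] := cS (p @ F) _; first exact: filterT.
  exists c; have [//|Fc] := in_ultra_setVsetC [set s | p s = c] UF.
  by have [x [xNc /xNc]] := cc (~` [set c]) _ Fc (discrete_set1 c).
pose c i := projT1 (cid (coord i)).
have Fc i : F [set s | set_val s i = c i] := projT2 (cid (coord i)).
have clim : (c : fqs_prod S) \in fqs_lim S.
  apply/mem_set => i j ij.
  have [s [<- <-]] := filter_ex (filterI (Fc i) (Fc j)).
  exact: fqs_lim_coord.
exists (exist _ (c : fqs_prod S) clim); split=> // N /(fiber_basis dI) [i iN].
by apply: filterS (Fc i) => s sc; apply: iN.
Qed.

Lemma fqs_lim_hausdorff (d : Order.disp_t) (I : preorderType d)
    (S : finQuandle_system I) : hausdorff_space (fqs_lim S).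
Proof.
move=> s t st; apply: val_inj; apply: functional_extensionality_dep => i.
have [u [us ut]] := st _ _ (fiber_nbhs i s) (fiber_nbhs i t).
exact: etrans (esym us) ut.
Qed.

(** * The topology of a profinite quandle *)

Lemma homeomorphism_compact (X Y : topologicalType) (h : X -> Y) :
  homeomorphism h -> compact [set: Y] -> compact [set: X].
Proof.
move=> [_ [g [gC hK _]]] cY.
have <- : g @` [set: Y] = [set: X].
  by apply/seteqP; split=> // x _; exists (h x).
by apply: continuous_compact cY; exact: continuous_subspaceT.
Qed.

Lemma continuous_inj_hausdorff (X Y : topologicalType) (h : X -> Y) :
  continuous h -> injective h -> hausdorff_space Y -> hausdorff_space X.
Proof.
move=> hC hI hY x y xy; apply/hI/hY => A B /hC Ax /hC By.
by have [z [Az Bz]] := xy _ _ Ax By; exists (h z).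
Qed.

Lemma profinite_compact (Q : topQuandleType) : profinite Q -> compact [set: Q].
Proof.
move=> [d [I [S [dI [h [hh _]]]]]].
exact: homeomorphism_compact hh (fqs_lim_compact dI).
Qed.

Lemma profinite_hausdorff (Q : topQuandleType) :
  profinite Q -> hausdorff_space Q.
Proof.
move=> [d [I [S [_ [h [[hC [g [_ hK _]]] _]]]]]].
exact: continuous_inj_hausdorff hC (can_inj hK) (@fqs_lim_hausdorff _ _ S).
Qed.

Lemma quandle_hom_div (P Q : quandleType) (f : P -> Q) :
  quandle_hom f -> {morph f : x y / x |>^-1 y}.
Proof. by move=> fM x y; rewrite -(qopK (f (x |>^-1 y)) (f y)) -fM qdivK. Qed.

Lemma kernel_congruence (P Q : quandleType) (f : P -> Q) :
  quandle_hom f -> congruence [set xy | f xy.1 = f xy.2].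
Proof.
move=> fM; split=> //= [x y z -> //|x y x' y'|x y x' y'].
  by rewrite !fM => -> ->.
by rewrite !quandle_hom_div// => -> ->.
Qed.

(** The class of [x] times the class of [y] is a rectangle around [(x, y)]
    inside the relation, so openness need only be checked class by class. *)
Lemma open_equivalenceP (X : topologicalType) (a : set (X * X)) :
  (forall x y, a (x, y) -> a (y, x)) ->
  (forall x y z, a (x, y) -> a (y, z) -> a (x, z)) ->
  open a <-> (forall x, a (x, x) -> nbhs x [set y | a (x, y)]).
Proof.
move=> aS aT; rewrite openE; split=> [aO x /aO [[U V]/= [Ux Vx] UVa]|aN].
  apply: filterS Vx => y Vy; apply: (UVa (x, y)); split=> //.
  exact: nbhs_singleton.
move=> [x y] axy; have ayx := aS _ _ axy.
exists ([set z | a (x, z)], [set z | a (y, z)]).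
  by split; apply: aN; [exact: aT ayx|exact: aT axy].
move=> [u v] [/= xu yv]; exact: aT (aS _ _ xu) (aT _ _ _ axy yv).
Qed.

(** Near each point some coordinate has its kernel inside [U], and so do all
    later coordinates; by compactness of [Q] one coordinate works at all points
    at once. *)
Lemma profinite_open_congruence (Q : topQuandleType) (U : set (Q * Q)) :
  profinite Q -> diag_entourage U ->
  exists a, [/\ congruence a, open a & a `<=` U].
Proof.
move=> pQ UD; have cQ := profinite_compact pQ.
have [d [I [S [dI [h [[hC [g [gC hK _]]] hM]]]]]] := pQ.
pose p i (x : Q) : S i := set_val (h x) i.
have pM i : quandle_hom (p i) by move=> x y; exact: hM.
pose a i := [set xy : Q * Q | p i xy.1 = p i xy.2].
suff [i iU] : exists i, a i `<=` U.
  exists (a i); split=> //; first exact: kernel_congruence.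
  apply/open_equivalenceP => [x y /esym //|x y z|x _]; first exact: etrans.
  have hx : nbhs x (h @^-1` fiber i (h x)) := hC x _ (fiber_nbhs i (h x)).
  by apply: filterS hx => y /esym.
have [[i0 _] dI2] := dI.
(* The filter of the sets of coordinates that contain all large ones. *)
pose G := filter_from [set: I] (fun i => [set j | (i <= j)%O]).
have FG : ProperFilter G.
  apply: filter_from_proper; last by move=> i _; exists i => /=.
  apply: filter_from_filter; first by exists i0.
  move=> i j _ _; have [k [ik jk]] := dI2 i j; exists k => // l kl.
  by split; [exact: Order.le_trans kl|exact: Order.le_trans kl].
have : \forall i \near G,
    [set: Q] `<=` (fun x => forall y, a i (x, y) -> U (x, y)).
  move/compact_near_coveringP : cQ; apply => x _.
  have [[V W]/= [Vx Wx] VWU] := UD (x, x) erefl.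
  have NVW : nbhs (h x) (g @^-1` (V `&` W)).
    by apply: gC; rewrite hK; exact: filterI.
  have [i iVW] := fiber_basis dI NVW.
  exists (h @^-1` fiber i (h x), [set j | (i <= j)%O]).
    split; last by exists i.
    exact: hC x _ (fiber_nbhs i (h x)).
  move=> [x' j] [/= xx' ij] y xy; apply: VWU.
  have yx : fiber i (h x) (h y).
    exact: etrans (fiber_le ij (esym xy : fiber j (h x') (h y))) xx'.
  by have := iVW _ xx'; have := iVW _ yx; rewrite /= !hK => -[_ ?] [? _].
by move=> /filter_ex [i iU]; exists i => -[x y]; exact: iU.
Qed.

(** * From compactness to invariant congruences *)

(** [fully_invariant] and [characteristic] are the cases where [M] is [qEnd Q]
    or [qAut Q]. *)
Definition invariant (X : Type) (M : set (X -> X)) (a : set (X * X)) : Prop :=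
  forall f, M f -> forall x y, a (x, y) -> a (f x, f y).

Lemma congruence_class_nbhs (Q : topQuandleType) (a : set (Q * Q)) (x : Q) :
  congruence a -> open a -> nbhs x [set y | a (x, y)].
Proof.
by move=> [aR aS aT _ _] /(open_equivalenceP aS aT); exact.
Qed.

Lemma congruence_class_clopen (Q : topQuandleType) (a : set (Q * Q)) (x : Q) :
  congruence a -> open a -> clopen [set y | a (x, y)].
Proof.
move=> aC aO; have [_ aS aT _ _] := aC; split.
  rewrite openE => y xy.
  by apply: filterS (congruence_class_nbhs y aC aO) => z; exact: aT.
rewrite -openC openE => y xNy.
apply: filterS (congruence_class_nbhs y aC aO) => z yz xz.
by apply: xNy; exact: aT xz (aS _ _ yz).
Qed.

Lemma congruence_bigcap (Q : quandleType) (M : set (Q -> Q)) (a : set (Q * Q)) :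
  (forall f, M f -> quandle_hom f) -> congruence a ->
  congruence [set xy | forall f, M f -> a (f xy.1, f xy.2)].
Proof.
move=> MH [aR aS aT aM aD]; split=> /=.
- by move=> x f _; exact: aR.
- by move=> x y xy f Mf; exact/aS/xy.
- by move=> x y z xy yz f Mf; exact: aT (xy f Mf) (yz f Mf).
- by move=> x y x' y' xy xy' f Mf; rewrite !(MH f Mf); apply: aM; auto.
- move=> x y x' y' xy xy' f Mf; rewrite !(quandle_hom_div (MH f Mf)).
  by apply: aD; auto.
Qed.

(** For a single [f], the preimage [K] of the [a]-class of [f x] is a clopen,
    hence compact, neighbourhood of [x]. Mapping [K] into that class is then an open
    condition in the compact-open topology, so [K] serves all maps close to [f];
    by compactness of [M] a neighbourhood of [x] serves all of [M]. *)
Lemma compact_equicontinuous (Q : topQuandleType)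
    (M : set {compact-open, Q -> Q}) (a : set (Q * Q)) (x : Q) :
  compact [set: Q] -> compact M ->
  (forall f : Q -> Q, M f -> continuous f) -> congruence a -> open a ->
  \forall y \near x, forall f : Q -> Q, M f -> a (f x, f y).
Proof.
move=> cQ cM MC aC aO; have [aR aS aT _ _] := aC.
have /compact_near_coveringP/(_ _ (nbhs x) (fun y f => a (f x, f y)) _) := cM.
apply=> f Mf; have [clO clC] := congruence_class_clopen (f x) aC aO.
pose K := f @^-1` [set z | a (f x, z)].
have cK : compact K.
  apply: (subclosed_compact _ cQ) => //.
  by apply: closed_comp => // z _; exact: MC.
exists ([set g : {compact-open, Q -> Q} | g @` K `<=` [set z | a (f x, z)]], K).
  split; last exact: (MC f Mf x _ (congruence_class_nbhs (f x) aC aO)).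
  apply: open_nbhs_nbhs; split; first exact: compact_open_open.
  by move=> _ [z Kz <-].
move=> [g y]/= [gK Ky]; apply: (aT _ (f x)).
  by apply/aS/gK; exists x => //; exact: aR.
by apply: gK; exists y.
Qed.

Lemma compact_invariant_fundamental_system (Q : topQuandleType)
    (M : set {compact-open, Q -> Q}) :
  profinite Q -> compact M -> M `<=` qEnd Q -> M id ->
  (forall f g : Q -> Q, M f -> M g -> M (f \o g)) ->
  exists B : set_system (Q * Q),
    fundamental_system B /\ (forall a, B a -> open a /\ invariant M a).
Proof.
move=> pQ cM ME M1 Mo; have cQ := profinite_compact pQ.
exists [set a | [/\ congruence a, open a & invariant M a]].
split; last by move=> a [].
split=> [a [aC aO _]|U /(profinite_open_congruence pQ) [a [aC aO aU]]].
  have [aR _ _ _ _] := aC; split=> // -[x y]/diagonalP ->.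
  by apply: open_nbhs_nbhs; split.
pose b := [set xy : Q * Q | forall f : Q -> Q, M f -> a (f xy.1, f xy.2)].
have bC : congruence b by apply: congruence_bigcap => // f /ME [].
exists b; last by move=> [x y] /(_ _ M1) /aU.
split=> //; last by move=> f Mf x y xy g Mg; exact: xy (Mo _ _ Mg Mf).
have [_ bS bT _ _] := bC; apply/open_equivalenceP => // x _.
by apply: compact_equicontinuous => // f /ME [].
Qed.

(** * From invariant congruences to compactness *)

Lemma closed_open_diag_entourage (X : topologicalType) (K O : set X) :
  closed K -> open O -> K `<=` O ->
  diag_entourage [set xy : X * X | K xy.1 -> O xy.2].
Proof.
move=> clK oO KO [x _] /diagonalP <-; have [Kx|KNx] := pselect (K x).
  exists (setT, O); last by move=> [y z] [_ Oz] _.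
  by split; [exact: filterT|apply: open_nbhs_nbhs; split=> //; exact: KO].
exists (~` K, setT); last by move=> [y z] [yNK _] /yNK.
split; last exact: filterT.
by apply: open_nbhs_nbhs; split=> //; exact: closed_openC.
Qed.

(** If [g] maps a compact set [K] into an open set [O], the image [g @` K] is
    closed, and [closed_open_diag_entourage] gives an entourage whose sections at the points
    of [g @` K] lie in [O]. *)
Lemma uniform_cvg_compact_open (Q : topologicalType)
    (F : set_system {compact-open, Q -> Q}) (g : {compact-open, Q -> Q}) :
  hausdorff_space Q -> continuous (g : Q -> Q) -> Filter F ->
  (forall U, diag_entourage U -> F [set f | forall x, U (g x, f x)]) ->
  F --> g.
Proof.
move=> hQ gC FF gF; apply/compact_open_cvgP => K O cK oO gKO.
have clgK : closed (g @` K).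
  apply: compact_closed => //; apply: continuous_compact => //.
  exact: continuous_subspaceT.
apply: filterS (gF _ (closed_open_diag_entourage clgK oO gKO)) => f fU.
by move=> _ [x Kx <-]; apply: fU; exists x.
Qed.

Lemma fundamental_system_nbhs (Q : topQuandleType) (B : set_system (Q * Q))
    (x : Q) (N : set Q) :
  hausdorff_space Q -> fundamental_system B -> nbhs x N ->
  exists2 a, B a & forall y, a (x, y) -> N y.
Proof.
move=> hQ [_ BF]; rewrite nbhsE => -[O [oO Ox] ON].
have clx : closed [set x].
  by apply: accessible_closed_set1; exact: hausdorff_accessible.
have xO : [set x] `<=` O by move=> _ ->.
have [a Ba aU] := BF _ (closed_open_diag_entourage clx oO xO).
by exists a => // y /aU /(_ erefl) /ON.
Qed.

Lemma fundamental_system_separated (Q : topQuandleType) (B : set_system (Q * Q))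
    (x y : Q) :
  hausdorff_space Q -> fundamental_system B ->
  (forall a, B a -> a (x, y)) -> x = y.
Proof.
move=> hQ BF xy; apply: (hQ) => N V Nx /nbhs_singleton Vy; exists y; split=> //.
by have [a /xy axy aN] := fundamental_system_nbhs hQ BF Nx; exact: aN.
Qed.

Lemma ultra_uniform_limit (Q : topQuandleType) (B : set_system (Q * Q))
    (M : set {compact-open, Q -> Q}) (F : set_system {compact-open, Q -> Q}) :
  compact [set: Q] -> hausdorff_space Q -> M `<=` qEnd Q ->
  fundamental_system B -> (forall a, B a -> open a /\ invariant M a) ->
  UltraFilter F -> F M ->
  exists g : {compact-open, Q -> Q}, [/\ qEnd Q g,
    forall a, B a -> F [set f | forall x, a (g x, f x)] & F --> g].
Proof.
move=> cQ hQ ME BF BM UF FM; have [BC Bsub] := BF.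
(* [g] is the pointwise limit of [F], by compactness of [Q]. *)
have pt (x : Q) : exists y : Q,
    forall N, nbhs y N -> F [set f : {compact-open, Q -> Q} | N (f x)].
  have PF : ProperFilter ((fun f : {compact-open, Q -> Q} => f x) @ F).
    exact: fmap_proper_filter.
  have [|y [_ yc]] := cQ _ PF; first exact: filterT.
  exists y => N Ny.
  have [//|NF] :=
    in_ultra_setVsetC [set f : {compact-open, Q -> Q} | N (f x)] UF.
  by have [z [Nz /Nz]] := yc (~` N) N NF Ny.
pose g x : Q := projT1 (cid (pt x)).
have gP x N : nbhs (g x) N -> F [set f : {compact-open, Q -> Q} | N (f x)].
  exact: (projT2 (cid (pt x)) N).
have gF a x : B a -> F [set f | a (g x, f x)].
  move=> Ba; have [aC _] := BC _ Ba; have [aO _] := BM _ Ba.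
  exact: gP (congruence_class_nbhs (g x) aC aO).
(* A member of [M] that is [a]-close to [g] at both points transfers invariance
   to the limit. *)
have gI a : B a -> forall x y, a (x, y) -> a (g x, g y).
  move=> Ba x y xy; have [[_ aS aT _ _] _] := BC _ Ba; have [_ aM] := BM _ Ba.
  have [f [[fx fy] Mf]] :=
    filter_ex (filterI (filterI (gF a x Ba) (gF a y Ba)) FM).
  exact: aT fx (aT _ _ _ (aM _ Mf _ _ xy) (aS _ _ fy)).
(* Being [a]-close to [g] at one point propagates to the whole [a]-class of that
   point, by invariance; as the classes are open, compactness of [Q] makes it
   hold at all points. *)
have gU a : B a -> F [set f | forall x, a (g x, f x)].
  move=> Ba; have [aC _] := BC _ Ba; have [aO aM] := BM _ Ba.
  have [aR aS aT _ _] := aC.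
  have : \forall f \near F, [set: Q] `<=` (fun x => a (g x, f x)).
    move/compact_near_coveringP : cQ; apply => x _.
    exists ([set y | a (x, y)], M `&` [set f | a (g x, f x)]).
      by split; [exact: congruence_class_nbhs|apply: filterI => //; exact: gF].
    move=> [y f]/= [xy [Mf gfx]].
    exact: aT (aS _ _ (gI _ Ba _ _ xy)) (aT _ _ _ gfx (aM _ Mf _ _ xy)).
  by apply: filterS => f af x; exact: af.
have gC : continuous g.
  move=> x N /(fundamental_system_nbhs hQ BF) [a Ba aN].
  have [aC _] := BC _ Ba; have [aO _] := BM _ Ba.
  by apply: filterS (congruence_class_nbhs x aC aO) => y /(gI _ Ba) /aN.
exists g; split=> //.
  split=> // x y; apply: (fundamental_system_separated hQ BF) => a Ba.
  have [[_ aS aT aM _] _] := BC _ Ba.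
  have [f [fa /ME [_ fH]]] := filter_ex (filterI (gU a Ba) FM).
  apply: (aT _ _ _ (fa _)); rewrite fH; apply: aM; exact/aS/fa.
apply: uniform_cvg_compact_open => // U /Bsub [a Ba aU].
by apply: filterS (gU a Ba) => f fa x; exact/aU/fa.
Qed.

Lemma compact_can_continuous (X Y : topologicalType) (f : X -> Y) (g : Y -> X) :
  compact [set: X] -> hausdorff_space Y -> continuous f ->
  cancel f g -> cancel g f -> continuous g.
Proof.
move=> cX hY fC fK gK; apply/continuousP => O oO.
have -> : g @^-1` O = ~` (f @` (~` O)).
  apply/seteqP; split=> [y /= Oy [x xNO xy]|y /= yN].
    by apply: xNO; rewrite -(fK x) xy.
  by apply: contrapT => gyN; apply: yN; exists (g y).
apply: closed_openC; apply: compact_closed => //; apply: continuous_compact.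
  exact: continuous_subspaceT.
by apply: (subclosed_compact _ cX) => //; exact: open_closedC.
Qed.

Lemma qAut_inv (Q : topQuandleType) (f g : Q -> Q) :
  compact [set: Q] -> hausdorff_space Q -> qAut Q f ->
  cancel f g -> cancel g f -> qAut Q g.
Proof.
move=> cQ hQ [fC fH _] fK gK; split; last by exists f.
  exact: compact_can_continuous fC fK gK.
by move=> x y; rewrite -{1}(gK x) -{1}(gK y) -fH fK.
Qed.

(** Uniform limits of bijections need not be bijective. Here injectivity comes
    from the invariance of the congruences under the inverses of the
    approximating automorphisms, and surjectivity from the image of [g] being
    both dense and compact. *)
Lemma qAut_uniform_limit (Q : topQuandleType) (B : set_system (Q * Q))
    (g : Q -> Q) :
  compact [set: Q] -> hausdorff_space Q -> fundamental_system B ->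
  (forall a, B a -> characteristic a) -> qEnd Q g ->
  (forall a, B a -> exists2 f : Q -> Q, qAut Q f & forall x, a (g x, f x)) ->
  qAut Q g.
Proof.
move=> cQ hQ BF BM [gC gH] gU; have [BC _] := BF.
have injg : injective g.
  move=> x y gxy; apply: (fundamental_system_separated hQ BF) => a Ba.
  have [[_ aS aT _ _] _] := BC _ Ba.
  have [f Af fa] := gU a Ba; have [_ _ [f' fK f'K]] := Af.
  rewrite -(fK x) -(fK y).
  apply: (BM _ Ba f' (qAut_inv cQ hQ Af fK f'K)).
  by apply: aT (aS _ _ (fa x)) _; rewrite gxy.
have surg y : exists x, g x = y.
  have clg : closed (range g).
    apply: compact_closed => //; apply: continuous_compact => //.
    exact: continuous_subspaceT.
  suff [x _ xy] : range g y by exists x.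
  apply: clg => N /(fundamental_system_nbhs hQ BF) [a Ba aN].
  have [[_ aS _ _ _] _] := BC _ Ba.
  have [f [_ _ [f' fK f'K]] fa] := gU a Ba.
  exists (g (f' y)); split; first by exists (f' y).
  by apply/aN/aS; have := fa (f' y); rewrite f'K.
split=> //; pose g' y := projT1 (cid (surg y)).
have g'K : cancel g' g by move=> y; exact: projT2 (cid (surg y)).
by exists g' => // x; apply: injg.
Qed.

Theorem theorem5p8 (Q : topQuandleType) (Q_profinite : profinite Q) :
  (compact (qEnd Q) <->
   exists B : set_system (Q * Q),
     fundamental_system B /\ (forall a, B a -> open a /\ fully_invariant a)) /\
  (compact (qAut Q) <->
   exists B : set_system (Q * Q),
     fundamental_system B /\ (forall a, B a -> open a /\ characteristic a)).
Proof.
have cQ := profinite_compact Q_profinite.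
have hQ := profinite_hausdorff Q_profinite.
have idC : continuous (id : Q -> Q) by move=> x; exact: cvg_id.
have compC (f g : Q -> Q) : continuous f -> continuous g -> continuous (f \o g).
  by move=> fC gC x; apply: continuous_comp; [exact: gC|exact: fC].
have compH (f g : Q -> Q) :
    quandle_hom f -> quandle_hom g -> quandle_hom (f \o g).
  by move=> fH gH x y; rewrite /= gH fH.
split; split.
- move=> cE; apply: (compact_invariant_fundamental_system Q_profinite cE) => //.
  by move=> f g [fC fH] [gC gH]; split; [exact: compC|exact: compH].
- move=> [B [BF BE]]; rewrite compact_ultra => F UF FE.
  have [g [gE _ Fg]] :=
    ultra_uniform_limit cQ hQ (@subset_refl _ _) BF BE UF FE.
  by exists g.
- move=> cA; apply: (compact_invariant_fundamental_system Q_profinite cA) => //.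
  + by move=> f [].
  + by split=> //; exists id.
  + move=> f g [fC fH fB] [gC gH gB].
    by split; [exact: compC|exact: compH|exact: bij_comp].
- move=> [B [BF BA]]; rewrite compact_ultra => F UF FA.
  have AE : qAut Q `<=` qEnd Q by move=> f [].
  have [g [gE gU Fg]] := ultra_uniform_limit cQ hQ AE BF BA UF FA.
  exists g; split=> //.
  apply: (qAut_uniform_limit cQ hQ BF) => // [a /BA [] //|a Ba].
  by have [f [fa Af]] := filter_ex (filterI (gU a Ba) FA); exists f.
Qed.
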